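(* Let $\beta: I\to M\subset G^3$ be a unit-speed curve on a surface $M$ in the Galilean space $G^3$, with geodesic torsion $\tau_g$, which is an asymptotic curve ($\kappa_n\equiv0$) and a Salkowski curve (its curvature $\kappa$ is constant and its torsion $\tau$ is not constant). Then its position vector is given by $$\beta(x)=\Bigg(x,\ \int\!\!\int e\sin\Big(\int\tau_g(x)dx\Big)dx\,dx,\ \int\!\!\int e\cos\Big(\int\tau_g(x)dx\Big)dx\,dx\Bigg),$$ where $e$ is a constant.
   Context: The Galilean space $G^3$ is $\mathbb R^3$ with the scalar product $\mathbf v\cdot_G\mathbf w=v_1w_1$ if $v_1\ne0$ or $w_1\neq 0$, and $\mathbf v\cdot_G\mathbf w=v_2w_2+v_3w_3$ if $v_1=w_1=0$; the norm is $\|\mathbf v\|_G=\sqrt{|\mathbf v\cdot_G\mathbf v|}$ and the cross product is $\mathbf v\times_G\mathbf w=(0,\,v_3w_1-v_1w_3,\,v_1w_2-v_2w_1)$. A unit-speed curve (parametrized by arc length) is one of the form $\beta(x)=(x,y(x),z(x))$, $x\in I\subset\mathbb R$. Its curvature is $\kappa=\|\beta''\|_G$, assumed positive, and its torsion is $\tau=\det(\beta',\beta'',\beta''')/\kappa^2$. $M$ is oriented; the Darboux frame of $\beta$ with respect to $M$ is $\{\mathbf T,\mathbf Q,\mathbf n\}$ with $\mathbf T=\beta'$, $\mathbf n$ the unit normal of $M$ along $\beta$ (a vector field with first component $0$), and $\mathbf Q=\mathbf n\times_G\mathbf T$. The geodesic curvature $\kappa_g$, normal curvature $\kappa_n$ and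 geodesic torsion $\tau_g$ are the functions in $\mathbf T'=\kappa_g\mathbf Q+\kappa_n\mathbf n$, $\mathbf Q'=\tau_g\mathbf n$, $\mathbf n'=-\tau_g\mathbf Q$. The symbol $\int g(x)\,dx$ denotes an antiderivative of $g$, the constants of integration being suitably chosen.
   Formalization: The third component carries a minus sign: with Q = n ×_G T and n' = −τ_g Q, an asymptotic curve has τ = τ_g, while the printed curve has torsion −τ_g, so the printed formula fails for every such curve. *)

(* Defs.v *)
(* Classical real numbers of the standard library, with Coquelicot. *)
From Stdlib Require Import Reals.
From Coquelicot Require Import Coquelicot.
Open Scope R_scope.

(** ** The Galilean space G^3 *)

(* The carrier is a Coquelicot product, so that [is_derive], [plus], [scal],
   [opp], [open] and [locally] are available on it. *)
Definition V3 : Type := (R * R * R)%type.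

Definition cx (v : V3) : R := fst (fst v).
Definition cy (v : V3) : R := snd (fst v).
Definition cz (v : V3) : R := snd v.

Definition gdot (v w : V3) : R :=
  if Req_EM_T (cx v) 0 then
    if Req_EM_T (cx w) 0 then cy v * cy w + cz v * cz w else cx v * cx w
  else cx v * cx w.

Definition gnorm (v : V3) : R := sqrt (Rabs (gdot v v)).

Definition gcross (v w : V3) : V3 :=
  (0, cz v * cx w - cx v * cz w, cx v * cy w - cy v * cx w).

Definition gnormalize (v : V3) : V3 := scal (/ gnorm v) v.

Definition det3 (u v w : V3) : R :=
  cx u * (cy v * cz w - cz v * cy w)
  - cy u * (cx v * cz w - cz v * cx w)
  + cz u * (cx v * cy w - cy v * cx w).

(** ** Oriented surfaces *)

Definition partial1 (f : R * R -> R) (s : R * R) : R :=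
  Derive (fun t => f (t, snd s)) (fst s).
Definition partial2 (f : R * R -> R) (s : R * R) : R :=
  Derive (fun t => f (fst s, t)) (snd s).

Definition C1_at (f : R * R -> R) (s : R * R) : Prop :=
  ex_derive (fun t => f (t, snd s)) (fst s) /\
  ex_derive (fun t => f (fst s, t)) (snd s) /\
  continuous (partial1 f) s /\ continuous (partial2 f) s.

Definition vpartial1 (r : R * R -> V3) (s : R * R) : V3 :=
  (partial1 (fun t => cx (r t)) s, partial1 (fun t => cy (r t)) s,
   partial1 (fun t => cz (r t)) s).
Definition vpartial2 (r : R * R -> V3) (s : R * R) : V3 :=
  (partial2 (fun t => cx (r t)) s, partial2 (fun t => cy (r t)) s,
   partial2 (fun t => cz (r t)) s).

(* [M] is a surface of G^3 oriented by its Galilean unit normal field [N]: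
   around each of its points, [M] is the homeomorphic image [r(U)] of an open
   subset of the plane, with [N] the normalization of r_u x_G r_v.
   The condition r_u x_G r_v <> 0 says that the surface is regular and that no
   tangent plane is parallel to the plane x = 0 (where there is no Galilean
   normal).  It costs nothing for a surface containing a curve (x, y(x), z(x)):
   it holds at the points of the curve, hence on a neighbourhood of it in M. *)
Definition oriented_surface (M : V3 -> Prop) (N : V3 -> V3) : Prop :=
  forall p : V3, M p ->
  exists (W : V3 -> Prop) (U : R * R -> Prop)
         (r : R * R -> V3) (g : V3 -> R * R),
    open W /\ W p /\ open U /\
    (forall s, U s -> M (r s) /\ W (r s) /\ g (r s) = s) /\
    (forall q, M q -> W q ->
       U (g q) /\ r (g q) = q /\
       filterlim g (within (fun q' => M q' /\ W q') (locally q))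
                   (locally (g q))) /\
    (forall s, U s ->
       C1_at (fun t => cx (r t)) s /\
       C1_at (fun t => cy (r t)) s /\
       C1_at (fun t => cz (r t)) s /\
       gcross (vpartial1 r s) (vpartial2 r s) <> (0, 0, 0) /\
       N (r s) = gnormalize (gcross (vpartial1 r s) (vpartial2 r s))).

(** ** Curves *)

Definition interval_oo (a b : Rbar) (x : R) : Prop :=
  Rbar_lt a x /\ Rbar_lt x b.

Definition C3_on (I : R -> Prop) (f : R -> R) : Prop :=
  forall x, I x ->
    ex_derive_n f 1 x /\ ex_derive_n f 2 x /\ ex_derive_n f 3 x /\
    continuous (Derive_n f 3) x.

Definition unit_speed_curve (I : R -> Prop) (beta : R -> V3) : Prop :=
  (forall x, I x -> cx (beta x) = x) /\
  C3_on I (fun x => cy (beta x)) /\ C3_on I (fun x => cz (beta x)).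

Definition vDerive_n (beta : R -> V3) (k : nat) (x : R) : V3 :=
  (Derive_n (fun t => cx (beta t)) k x,
   Derive_n (fun t => cy (beta t)) k x,
   Derive_n (fun t => cz (beta t)) k x).

Definition curvature (beta : R -> V3) (x : R) : R :=
  gnorm (vDerive_n beta 2 x).

Definition torsion (beta : R -> V3) (x : R) : R :=
  det3 (vDerive_n beta 1 x) (vDerive_n beta 2 x) (vDerive_n beta 3 x)
  / (curvature beta x) ^ 2.

Definition constant_on (I : R -> Prop) (f : R -> R) : Prop :=
  exists c, forall x, I x -> f x = c.

Definition salkowski (I : R -> Prop) (beta : R -> V3) : Prop :=
  constant_on I (curvature beta) /\ ~ constant_on I (torsion beta).

(** ** Darboux frame along a curve of a surface with unit normal field [N] *)

Definition frame_T (beta : R -> V3) (x : R) : V3 := vDerive_n beta 1 x.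
Definition frame_n (N : V3 -> V3) (beta : R -> V3) (x : R) : V3 := N (beta x).
Definition frame_Q (N : V3 -> V3) (beta : R -> V3) (x : R) : V3 :=
  gcross (frame_n N beta x) (frame_T beta x).

(* [kg], [kn], [tg] are the geodesic curvature, the normal curvature and the
   geodesic torsion. *)
Definition darboux_equations (I : R -> Prop) (N : V3 -> V3) (beta : R -> V3)
    (kg kn tg : R -> R) : Prop :=
  forall x, I x ->
    is_derive (frame_T beta) x
      (plus (scal (kg x) (frame_Q N beta x)) (scal (kn x) (frame_n N beta x))) /\
    is_derive (frame_Q N beta) x (scal (tg x) (frame_n N beta x)) /\
    is_derive (frame_n N beta) x (opp (scal (tg x) (frame_Q N beta x))).

Definition asymptotic (I : R -> Prop) (kn : R -> R) : Prop :=
  forall x, I x -> kn x = 0.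

(** ** Antiderivatives *)

Definition antiderivative_on (I : R -> Prop) (f F : R -> R) : Prop :=
  forall x, I x -> is_derive F x (f x).

Definition double_antiderivative_on (I : R -> Prop) (f F : R -> R) : Prop :=
  exists G, antiderivative_on I f G /\ antiderivative_on I G F.

(* Main.v *)
(* Writing n = (0, u, v), the frame is T = (1, y', z') and Q = (0, v, -u), so
   T' = kg Q reads y'' = kg v, z'' = - kg u, whence kappa = |kg|.  As
   kg = y'' v - z'' u is differentiable with constant square, it is a constant
   e <> 0.  Then (u, v) = (- z'', y'') / e is C^1, so tau_g is continuous, and
   u' = - tau_g v, v' = tau_g u force (u, v) = (cos theta, sin theta) for a
   suitable antiderivative theta of tau_g. *)
Require Import Defs.
From Stdlib Require Import Reals Lra.
From Coquelicot Require Import Coquelicot.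
Open Scope R_scope.

(** * Calculus on an open interval with possibly infinite ends *)

Lemma locally_interval_oo (a b : Rbar) (x : R) :
  interval_oo a b x -> locally x (interval_oo a b).
Proof.
intros [Ha Hb].
apply filter_and.
- exact (open_Rbar_gt a x Ha).
- exact (open_Rbar_lt b x Hb).
Qed.

Lemma interval_oo_convex (a b : Rbar) (x y t : R) :
  interval_oo a b x -> interval_oo a b y -> x <= t <= y -> interval_oo a b t.
Proof.
intros [Ha _] [_ Hb] [H1 H2]; split.
- now apply Rbar_lt_le_trans with x.
- now apply Rbar_le_lt_trans with y.
Qed.

Lemma interval_oo_between (a b : Rbar) (x y t : R) :
  interval_oo a b x -> interval_oo a b y ->
  Rmin x y <= t <= Rmax x y -> interval_oo a b t.
Proof.
intros Hx Hy; unfold Rmin, Rmax; destruct (Rle_dec x y).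
- now apply interval_oo_convex.
- now apply interval_oo_convex.
Qed.

Lemma is_derive_zero_constant_on (a b : Rbar) (f : R -> R) :
  (forall x, interval_oo a b x -> is_derive f x 0) ->
  forall x y, interval_oo a b x -> interval_oo a b y -> f x = f y.
Proof.
intros Hf.
assert (Hlt : forall x y, interval_oo a b x -> interval_oo a b y ->
              x < y -> f x = f y).
{ intros x y Hx Hy Hxy.
  apply (eq_is_derive f x y); [|exact Hxy].
  intros t Ht; apply Hf, (interval_oo_convex a b x y); assumption. }
intros x y Hx Hy; destruct (Rtotal_order x y) as [H|[->|H]]; auto.
symmetry; auto.
Qed.

(** Take [c] plus the integral of [f] from [x0]. The free value [c] later lets the angle start at a
    prescribed position. *)
Lemma continuous_antiderivative_on (a b : Rbar) (f : R -> R) (x0 c : R) :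
  interval_oo a b x0 ->
  (forall x, interval_oo a b x -> continuous f x) ->
  exists F, antiderivative_on (interval_oo a b) f F /\ F x0 = c.
Proof.
intros H0 Hc.
exists (fun x => c + RInt f x0 x); split.
- intros x Hx.
  replace (f x) with (0 + f x) by ring.
  apply (is_derive_plus (fun _ => c)).
  + apply (is_derive_const c).
  + apply (is_derive_RInt f (fun t => RInt f x0 t) x0); [|now apply Hc].
    apply (filter_imp (interval_oo a b)); [|now apply locally_interval_oo].
    intros t Ht; apply (RInt_correct f), (ex_RInt_continuous f).
    intros z Hz; apply Hc, (interval_oo_between a b x0 t); assumption.
- rewrite RInt_point; unfold zero; simpl; ring.
Qed.

(** * Angles of rotating unit vectors *)

(** Since the sine of [acos u] is the absolute value of [v], the angle is [acos u] or its opposite,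
    according to the sign of [v]. *)
Lemma unit_circle_angle (u v : R) :
  u ^ 2 + v ^ 2 = 1 -> exists t, u = cos t /\ v = sin t.
Proof.
intros H.
assert (Hu : -1 <= u <= 1) by nra.
assert (Hs : sin (acos u) = Rabs v).
{ rewrite sin_acos by exact Hu.
  rewrite <- sqrt_Rsqr_abs; f_equal; unfold Rsqr; nra. }
destruct (Rle_dec 0 v) as [Hv|Hv].
- exists (acos u); rewrite cos_acos, Hs, Rabs_pos_eq by lra; auto.
- exists (- acos u); rewrite cos_neg, sin_neg, cos_acos, Hs, Rabs_left by lra.
  split; ring.
Qed.

(** For an antiderivative [theta] of [k], the pair [(cos theta, sin theta)] solves the same linear
    system as [(u, v)]. Choosing [theta x0] to be an angle of [(u x0, v x0)] makes the two solutions
    agree at [x0], hence everywhere. *)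
Lemma rotation_ode_angle (a b : Rbar) (u v k : R -> R) :
  (forall x, interval_oo a b x -> u x ^ 2 + v x ^ 2 = 1) ->
  (forall x, interval_oo a b x -> is_derive u x (- (k x * v x))) ->
  (forall x, interval_oo a b x -> is_derive v x (k x * u x)) ->
  (forall x, interval_oo a b x -> continuous k x) ->
  forall x0, interval_oo a b x0 ->
  exists theta, antiderivative_on (interval_oo a b) k theta /\
    forall x, interval_oo a b x -> u x = cos (theta x) /\ v x = sin (theta x).
Proof.
intros H1 Hu Hv Hk x0 H0.
destruct (unit_circle_angle (u x0) (v x0) (H1 x0 H0)) as [t [Ht1 Ht2]].
destruct (continuous_antiderivative_on a b k x0 t H0 Hk) as [theta [Hth Hth0]].
exists theta; split; [exact Hth|].
(* Squared distance between the two solutions: the system is a rotation, so this is constant, and it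
   vanishes at [x0]. *)
set (W := fun x => (u x - cos (theta x)) ^ 2 + (v x - sin (theta x)) ^ 2).
assert (HW : forall x, interval_oo a b x -> is_derive W x 0).
{ intros x Hx; unfold W.
  assert (du := Hu x Hx); assert (dv := Hv x Hx); assert (dt := Hth x Hx).
  auto_derive.
  - repeat split; eexists; eassumption.
  - change (fun x => u x) with u; change (fun x => v x) with v;
      change (fun x => theta x) with theta.
    rewrite (is_derive_unique _ _ _ du), (is_derive_unique _ _ _ dv),
      (is_derive_unique _ _ _ dt); ring. }
intros x Hx.
assert (E := is_derive_zero_constant_on a b W HW x x0 Hx H0).
assert (E0 : W x0 = 0) by (unfold W; rewrite Hth0, Ht1, Ht2; ring).
rewrite E0 in E; unfold W in E; rewrite <- !Rsqr_pow2 in E.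
destruct (Rplus_sqr_eq_0 _ _ E); split; lra.
Qed.

(** * Derivatives of vector functions, component by component *)

(** Chain rule with a coordinate projection, which is linear and so is its own differential;
    likewise for the other two coordinates. *)
Lemma is_derive_cx (f : R -> V3) (x : R) (l : V3) :
  is_derive f x l -> is_derive (fun t => cx (f t)) x (cx l).
Proof.
intros H.
apply (filterdiff_comp' f (fun v : V3 => fst (fst v)) x
         (fun y => scal y l) (fun v : V3 => fst (fst v)) H).
apply (filterdiff_linear (fun v : V3 => fst (fst v))).
apply (is_linear_comp (fun v : V3 => fst v) fst); apply is_linear_fst.
Qed.

Lemma is_derive_cy (f : R -> V3) (x : R) (l : V3) :
  is_derive f x l -> is_derive (fun t => cy (f t)) x (cy l).
Proof.
intros H.
apply (filterdiff_comp' f (fun v : V3 => snd (fst v)) x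
         (fun y => scal y l) (fun v : V3 => snd (fst v)) H).
apply (filterdiff_linear (fun v : V3 => snd (fst v))).
apply (is_linear_comp (fun v : V3 => fst v) snd);
  [apply is_linear_fst | apply is_linear_snd].
Qed.

Lemma is_derive_cz (f : R -> V3) (x : R) (l : V3) :
  is_derive f x l -> is_derive (fun t => cz (f t)) x (cz l).
Proof.
intros H.
apply (filterdiff_comp' f (fun v : V3 => snd v) x
         (fun y => scal y l) (fun v : V3 => snd v) H).
apply (filterdiff_linear (fun v : V3 => snd v)), is_linear_snd.
Qed.

(** * Isotropic vectors, the unit normal and the Darboux frame *)

Lemma gnorm_isotropic (v : V3) : cx v = 0 -> gnorm v = sqrt (cy v ^ 2 + cz v ^ 2).
Proof.
intros H; unfold gnorm, gdot.
destruct (Req_EM_T (cx v) 0) as [_|K]; [|now elim K].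
f_equal; rewrite Rabs_pos_eq by nra; ring.
Qed.

Lemma gnormalize_isotropic_unit (v : V3) :
  cx v = 0 -> v <> (0, 0, 0) ->
  cx (gnormalize v) = 0 /\ cy (gnormalize v) ^ 2 + cz (gnormalize v) ^ 2 = 1.
Proof.
intros Hx Hv.
assert (Hp : 0 < cy v ^ 2 + cz v ^ 2).
{ assert (H : cy v ^ 2 + cz v ^ 2 <> 0).
  { intros K; apply Hv; destruct v as [[v1 v2] v3]; unfold cx, cy, cz in *; simpl in *.
    repeat f_equal; nra. }
  nra. }
assert (Hs := sqrt_lt_R0 _ Hp).
assert (Hq := pow2_sqrt _ (Rlt_le _ _ Hp)).
unfold gnormalize; rewrite gnorm_isotropic by exact Hx.
set (s := sqrt _) in *.
change (/ s * cx v = 0 /\ (/ s * cy v) ^ 2 + (/ s * cz v) ^ 2 = 1).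
rewrite Hx; split; [ring|].
replace ((/ s * cy v) ^ 2 + (/ s * cz v) ^ 2)
  with ((cy v ^ 2 + cz v ^ 2) / s ^ 2) by (field; lra).
rewrite Hq; field; lra.
Qed.

(** In a chart around [p], the normal is the normalization of a nonzero Galilean cross product, and
    every such product has first component 0. *)
Lemma oriented_surface_unit_normal (M : V3 -> Prop) (N : V3 -> V3) (p : V3) :
  oriented_surface M N -> M p ->
  cx (N p) = 0 /\ cy (N p) ^ 2 + cz (N p) ^ 2 = 1.
Proof.
intros HM Hp.
destruct (HM p Hp) as (W & U & r & g & _ & HW & _ & _ & Hg & Hr).
destruct (Hg p Hp HW) as [HU [Hrg _]].
destruct (Hr _ HU) as (_ & _ & _ & Hne & HN).
rewrite Hrg in HN; rewrite HN.
now apply gnormalize_isotropic_unit.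
Qed.

(** The first coordinate of [beta] is the identity near [x], so [T] has first component 1; the rest
    is the formula of the cross product. *)
Lemma unit_speed_frame_Q (a b : Rbar) (N : V3 -> V3) (beta : R -> V3) (x : R) :
  unit_speed_curve (interval_oo a b) beta -> interval_oo a b x ->
  cx (N (beta x)) = 0 ->
  frame_Q N beta x = (0, cz (N (beta x)), - cy (N (beta x))).
Proof.
intros [Hb _] Hx Hn.
assert (H1 : cx (frame_T beta x) = 1).
{ unfold frame_T, vDerive_n; unfold cx at 1; simpl.
  rewrite (Derive_ext_loc _ (fun t => t)).
  - apply Derive_id.
  - apply (filter_imp (interval_oo a b)); [exact Hb|].
    now apply locally_interval_oo. }
unfold frame_Q, gcross, frame_n; rewrite Hn, H1.
repeat f_equal; ring.
Qed.

(** * Iterated derivatives and functions of constant square *)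

Lemma ex_derive_n_is_derive (f : R -> R) (n : nat) (x : R) :
  ex_derive_n f (S n) x -> is_derive (Derive_n f n) x (Derive_n f (S n) x).
Proof.
exact (Derive_correct (Derive_n f n) x).
Qed.

(** Differentiating [f ^ 2 = c] gives [2 * f * f' = 0], and [f] never vanishes because [c] is
    nonzero; so [f' = 0]. *)
Lemma is_derive_square_constant (a b : Rbar) (f : R -> R) (c : R) :
  c <> 0 ->
  (forall x, interval_oo a b x -> ex_derive f x) ->
  (forall x, interval_oo a b x -> f x ^ 2 = c) ->
  forall x y, interval_oo a b x -> interval_oo a b y -> f x = f y.
Proof.
intros Hc Hd Hsq; apply is_derive_zero_constant_on.
intros x Hx.
assert (D := Derive_correct f x (Hd x Hx)).
assert (D2 : is_derive (fun t => f t ^ 2) x (2 * f x * Derive f x)).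
{ auto_derive; [now apply Hd|].
  change (fun x => f x) with f; ring. }
assert (D0 : is_derive (fun t => f t ^ 2) x 0).
{ apply (is_derive_ext_loc (fun _ => c)); [|apply (is_derive_const c)].
  apply (filter_imp (interval_oo a b)); [|now apply locally_interval_oo].
  intros t Ht; symmetry; now apply Hsq. }
assert (E : 2 * f x * Derive f x = 0)
  by (rewrite <- (is_derive_unique _ _ _ D2); exact (is_derive_unique _ _ _ D0)).
assert (Hf : f x <> 0) by (intros K; apply Hc; rewrite <- (Hsq x Hx), K; ring).
replace 0 with (Derive f x) by nra.
exact D.
Qed.

(* The minus sign in the third component is forced by the conventions
   Q = n x_G T and Q' = tau_g n: for them tau = tau_g along the curve, whereas
   (x, Y, Z) has torsion - tau_g. *)
Theorem corollary4p10 :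
  forall (a b : Rbar) (M : V3 -> Prop) (N : V3 -> V3) (beta : R -> V3)
         (kg kn tg : R -> R),
    oriented_surface M N ->
    unit_speed_curve (interval_oo a b) beta ->
    (forall x, interval_oo a b x -> M (beta x)) ->
    (forall x, interval_oo a b x -> 0 < curvature beta x) ->
    darboux_equations (interval_oo a b) N beta kg kn tg ->
    asymptotic (interval_oo a b) kn ->
    salkowski (interval_oo a b) beta ->
    exists (e : R) (theta Y Z : R -> R),
      antiderivative_on (interval_oo a b) tg theta /\
      double_antiderivative_on (interval_oo a b)
        (fun x => e * sin (theta x)) Y /\
      double_antiderivative_on (interval_oo a b)
        (fun x => e * cos (theta x)) Z /\
      forall x, interval_oo a b x -> beta x = (x, Y x, - Z x).
Proof.
intros a b M N beta kg kn tg HM Hus HbM Hpos Hdar Hasy [[c Hc] Htau].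
set (I := interval_oo a b) in *.
(* On an empty interval every function is constant, so a nonconstant torsion provides a base
   point. *)
assert (HI : exists x0, I x0).
{ destruct (Classical_Prop.classic (exists x0, I x0)) as [H|H]; [exact H|].
  elim Htau; exists 0; intros x Hx; elim H; now exists x. }
destruct HI as [x0 Hx0].
set (u := fun x => cy (N (beta x))).
set (v := fun x => cz (N (beta x))).
set (y := fun x => cy (beta x)).
set (z := fun x => cz (beta x)).
assert (Hn0 : forall x, I x -> cx (N (beta x)) = 0).
{ intros x Hx; now apply (oriented_surface_unit_normal M N (beta x) HM), HbM. }
assert (Hn1 : forall x, I x -> u x ^ 2 + v x ^ 2 = 1).
{ intros x Hx; now apply (oriented_surface_unit_normal M N (beta x) HM), HbM. }
assert (HQ : forall x, I x -> frame_Q N beta x = (0, v x, - u x)).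
{ intros x Hx; apply (unit_speed_frame_Q a b); auto. }
(* The equation [n' = - tg Q], read in coordinates, is the rotation system for [(u, v)]. *)
assert (Hu : forall x, I x -> is_derive u x (- (tg x * v x))).
{ intros x Hx; destruct (Hdar x Hx) as (_ & _ & D).
  apply is_derive_cy in D; rewrite (HQ x Hx) in D; exact D. }
assert (Hv : forall x, I x -> is_derive v x (tg x * u x)).
{ intros x Hx; destruct (Hdar x Hx) as (_ & _ & D).
  apply is_derive_cz in D; rewrite (HQ x Hx) in D.
  replace (tg x * u x) with (- (tg x * - u x)) by ring; exact D. }
assert (HT : forall x, I x -> is_derive (frame_T beta) x (0, kg x * v x, - (kg x * u x))).
{ intros x Hx; destruct (Hdar x Hx) as (D & _ & _).
  rewrite (HQ x Hx), (Hasy x Hx) in D.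
  match type of D with is_derive _ _ ?l =>
    replace (0, kg x * v x, - (kg x * u x)) with l; [exact D|] end.
  unfold frame_n; destruct (N (beta x)) as [[n1 n2] n3].
  apply injective_projections; [apply injective_projections|]; simpl;
    unfold plus, scal, mult; simpl; unfold mult; simpl; ring. }
assert (Hy2 : forall x, I x -> is_derive (Derive_n y 1) x (kg x * v x)).
{ intros x Hx; exact (is_derive_cy _ _ _ (HT x Hx)). }
assert (Hz2 : forall x, I x -> is_derive (Derive_n z 1) x (- (kg x * u x))).
{ intros x Hx; exact (is_derive_cz _ _ _ (HT x Hx)). }
assert (Ey : forall x, I x -> Derive_n y 2 x = kg x * v x).
{ intros x Hx; exact (is_derive_unique _ _ _ (Hy2 x Hx)). }
assert (Ez : forall x, I x -> Derive_n z 2 x = - (kg x * u x)).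
{ intros x Hx; exact (is_derive_unique _ _ _ (Hz2 x Hx)). }
(* As [kn] vanishes, the second derivative of [beta] is [kg] times the isotropic unit vector [Q].
   Squares avoid the unknown sign of [kg]. *)
assert (Hk : forall x, I x -> curvature beta x ^ 2 = kg x ^ 2).
{ intros x Hx; unfold curvature; rewrite gnorm_isotropic.
  - rewrite pow2_sqrt by nra.
    change (Derive_n y 2 x ^ 2 + Derive_n z 2 x ^ 2 = kg x ^ 2).
    rewrite (Ey x Hx), (Ez x Hx).
    transitivity (kg x ^ 2 * (u x ^ 2 + v x ^ 2)); [ring|].
    rewrite (Hn1 x Hx); ring.
  - exact (is_derive_unique _ _ _ (is_derive_cx _ _ _ (HT x Hx))). }
assert (Hc0 : 0 < c) by (rewrite <- (Hc x0 Hx0); auto).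
destruct Hus as (Hbx & Hy & Hz).
assert (Hy3 : forall x, I x -> is_derive (Derive_n y 2) x (Derive_n y 3 x)).
{ intros x Hx; apply ex_derive_n_is_derive, (Hy x Hx). }
assert (Hz3 : forall x, I x -> is_derive (Derive_n z 2) x (Derive_n z 3 x)).
{ intros x Hx; apply ex_derive_n_is_derive, (Hz x Hx). }
assert (Hloc : forall x, I x -> locally x I) by exact (locally_interval_oo a b).
(* Scalar product of [T'] with [Q]. It writes [kg] in terms of differentiable functions, which
   yields its own differentiability. *)
assert (Ekg : forall x, I x -> Derive_n y 2 x * v x - Derive_n z 2 x * u x = kg x).
{ intros x Hx; rewrite (Ey x Hx), (Ez x Hx).
  transitivity (kg x * (u x ^ 2 + v x ^ 2)); [ring|].
  rewrite (Hn1 x Hx); ring. }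
assert (Hkgd : forall x, I x -> ex_derive kg x).
{ intros x Hx.
  apply (ex_derive_ext_loc (fun t => Derive_n y 2 t * v t - Derive_n z 2 t * u t)).
  - apply (filter_imp I); [exact Ekg|auto].
  - apply (ex_derive_minus (fun t => Derive_n y 2 t * v t)
             (fun t => Derive_n z 2 t * u t));
      apply ex_derive_mult; eexists; eauto. }
assert (Hkg : forall x, I x -> kg x = kg x0).
{ intros x Hx; apply (is_derive_square_constant a b kg (c ^ 2)); auto.
  - nra.
  - intros t Ht; rewrite <- (Hk t Ht), (Hc t Ht); reflexivity. }
(* The constant of the statement is the value of the geodesic curvature; its square is [c ^ 2]. *)
set (e := kg x0) in *.
assert (He : e <> 0).
{ intros K; assert (H := Hk x0 Hx0); fold e in H; rewrite K, (Hc x0 Hx0) in H; nra. }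
(* Differentiating [y'' = e v] and [z'' = - e u] gives [y''' = e tg u] and [z''' = e tg v]; solve
   for [tg] using [u ^ 2 + v ^ 2 = 1]. The left side is continuous because [beta] is of class C^3,
   so [tg] can be integrated. *)
assert (Htg : forall x, I x ->
          (Derive_n y 3 x * u x + Derive_n z 3 x * v x) * / e = tg x).
{ intros x Hx.
  assert (E1 : Derive_n y 3 x = e * (tg x * u x)).
  { apply is_derive_unique.
    apply (is_derive_ext_loc (fun t => e * v t)).
    - apply (filter_imp I); [|auto].
      intros t Ht; rewrite <- (Hkg t Ht); symmetry; exact (Ey t Ht).
    - apply is_derive_scal; auto. }
  assert (E2 : Derive_n z 3 x = - e * - (tg x * v x)).
  { apply is_derive_unique.
    apply (is_derive_ext_loc (fun t => - e * u t)).
    - apply (filter_imp I); [|auto].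
      intros t Ht; rewrite <- (Hkg t Ht).
      transitivity (- (kg t * u t)); [symmetry; apply Ropp_mult_distr_l|].
      symmetry; exact (Ez t Ht).
    - apply is_derive_scal; auto. }
  rewrite E1, E2.
  transitivity (tg x * (u x ^ 2 + v x ^ 2)); [field; exact He|].
  rewrite (Hn1 x Hx); ring. }
assert (Htgc : forall x, I x -> continuous tg x).
{ intros x Hx.
  apply (continuous_ext_loc _
           (fun t => (Derive_n y 3 t * u t + Derive_n z 3 t * v t) * / e)).
  - apply (filter_imp I); [exact Htg|auto].
  - apply (continuous_mult (fun t => Derive_n y 3 t * u t + Derive_n z 3 t * v t)
             (fun _ => / e)); [|apply continuous_const].
    apply (continuous_plus (fun t => Derive_n y 3 t * u t)
             (fun t => Derive_n z 3 t * v t)).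
    + apply (continuous_mult (Derive_n y 3) u); [apply (Hy x Hx)|].
      apply (ex_derive_continuous u); eexists; auto.
    + apply (continuous_mult (Derive_n z 3) v); [apply (Hz x Hx)|].
      apply (ex_derive_continuous v); eexists; auto. }
destruct (rotation_ode_angle a b u v tg Hn1 Hu Hv Htgc x0 Hx0)
  as [theta [Hth Huv]].
(* The coordinates themselves are the double antiderivatives: [y'' = e v = e sin theta] and
   [(- z)'' = e u = e cos theta]. *)
exists e, theta, y, (fun x => - z x).
split; [exact Hth|]; split; [|split].
- exists (Derive_n y 1); split; intros x Hx.
  + rewrite <- (proj2 (Huv x Hx)), <- (Hkg x Hx); auto.
  + apply (ex_derive_n_is_derive y 0), (Hy x Hx).
- exists (fun x => - Derive_n z 1 x); split; intros x Hx.
  + rewrite <- (proj1 (Huv x Hx)), <- (Hkg x Hx).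
    rewrite <- (Ropp_involutive (kg x * u x)).
    apply (is_derive_opp (Derive_n z 1)); auto.
  + apply (is_derive_opp z), (ex_derive_n_is_derive z 0), (Hz x Hx).
- intros x Hx; rewrite Ropp_involutive; unfold y, z.
  (* The second occurrence of [x] is the first entry of the triple. *)
  rewrite <- (Hbx x Hx) at 2.
  unfold cx, cy, cz; now destruct (beta x) as [[? ?] ?].
Qed.
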